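(* Let $\eta=\{\eta_k\}_{k=0}^\infty\in\mathbb{H}$ satisfy $$\lim_{\rho\uparrow 1}(1-\rho)^{1+\delta}\sum_{k=0}^\infty\eta_k\rho^k=0\quad\text{for all }\delta>0.$$ For each $\rho\in(0,1)$ let $Y_{\rho,\eta}$ be a random variable with the same distribution as $\frac{\ln\rho}{\ln(1-\rho)}X_{\rho,\eta}$. Then $Y_{\rho,\eta}\to 1$ in probability as $\rho\uparrow 1$.
   Context: $\mathbb{H}$ is the set of all sequences $\eta=\{\eta_x\}_{x=0}^\infty$ of natural numbers (so $\eta_x\ge 1$ for all $x\ge0$) such that $\sum_{x=0}^\infty\eta_x\rho^x<\infty$ for all $\rho\in(0,1)$. Convergence in probability $Y_{\rho,\eta}\to1$ as $\rho\uparrow1$ means $\lim_{\rho\uparrow1}P(|Y_{\rho,\eta}-1|>\epsilon)=0$ for all $\epsilon>0$. Frog model with drift $\rho$ and frog distribution $\eta$. Fix $\rho\in(0,1)$ and let $p=\frac{1}{1+\rho}\in(\tfrac12,1)$, so that $\rho=\frac{1-p}{p}$; let $\eta\in\mathbb{H}$. At each site $x\in\mathbb{Z}$ with $x\ge 0$ there are initially $\eta_x$ particles (''frogs''), and there are no frogs at sites $x<0$. At time $0$ the $\eta_0$ frogs at the origin are active and all others are sleeping. Active frogs perform, in discrete time, simultaneously and independently of each other, nearest-neighbour random walks on $\mathbb{Z}$, each step being $+1$ with probability $p$ and $-1$ with probability $1-p$. When an active frog visits a site $x$ containing sleeping frogs, all $\eta_x$ of them become active and from then on each performs the same kind of random walk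 starting from its initial location; all random walk transitions are independent. $X_{\rho,\eta}$ denotes a random variable with the distribution of the negative of the minimum of the set of sites visited by active frogs (almost surely finite for $\eta\in\mathbb{H}$). *)

(* Defs.v *)
From HB Require Import structures.
From mathcomp Require Import all_boot all_order all_algebra.
From mathcomp Require Import all_classical all_reals all_analysis.
From mathcomp Require Import measurable_realfun.
Set Implicit Arguments.
Unset Strict Implicit.
Unset Printing Implicit Defensive.
Import Order.TTheory GRing.Theory Num.Theory.
Import numFieldNormedType.Exports.
Local Open Scope classical_set_scope.
Local Open Scope ring_scope.

Definition weighted_sum (R : realType) (eta : nat -> nat) (rho : R) : \bar R :=
  (\sum_(0 <= k <oo) ((eta k)%:R * rho ^+ k)%:E)%E.

Definition admissible (R : realType) (eta : nat -> nat) : Prop :=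
  (forall x, (0 < eta x)%N) /\
  (forall rho : R, 0 < rho < 1 -> (weighted_sum eta rho < +oo)%E).

(* [existT _ x i] is the [i]-th of the [eta x] frogs starting at site [x];
   there is no frog at a negative site. *)
Definition frog (eta : nat -> nat) : Type := {x : nat & 'I_(eta x)}.

(* [s f n] is the [n]-th jump of [f], counted from the moment [f] wakes up:
   [true] is a jump [+1] and [false] a jump [-1]. *)
Definition steps (eta : nat -> nat) : Type := frog eta -> nat -> bool.

Definition jump (b : bool) : int := if b then 1 else -1.

Definition walk (eta : nat -> nat) (s : steps eta) (f : frog eta) (a : nat)
    : int :=
  (tag f)%:Z + \sum_(k < a) jump (s f k).

(* The frogs of a site wake up together. At time [t], [awake s t x] is [Some a]
   if the frogs of site [x] woke up at time [t - a], and [None] if they are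
   still sleeping. A frog from an awake site [x] is then at [walk s f a]. *)
Fixpoint awake (eta : nat -> nat) (s : steps eta) (t x : nat) : option nat :=
  if t is t'.+1 then
    if awake s t' x is Some a then Some a.+1
    else if `[< exists (f : frog eta) (a : nat),
                  awake s t' (tag f) = Some a /\ walk s f a.+1 = x%:Z >]
         then Some 0%N else None
  else if x == 0%N then Some 0%N else None.

Definition visited (eta : nat -> nat) (s : steps eta) : set int :=
  [set z | exists (t : nat) (f : frog eta) (a : nat),
             awake s t (tag f) = Some a /\ walk s f a = z].

(* Extended-real valued: this is [+oo] on the null event that arbitrarily
   negative sites are visited. Otherwise the infimum is a minimum. *)
Definition neg_min_visited (R : realType) (eta : nat -> nat) (s : steps eta)
    : \bar R :=
  (- ereal_inf [set (z%:~R : R)%:E | z in visited s])%E.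

Definition mutually_independent d d' (T : measurableType d)
    (E : measurableType d') (R : realType) (P : probability T R)
    (I : eqType) (X : I -> {RV P >-> E}) : Prop :=
  forall (J : seq I) (B : I -> set E), uniq J ->
    (forall j, measurable (B j)) ->
    P (\bigcap_(j in [set` J]) (X j @^-1` B j)) =
    (\prod_(j <- J) P (X j @^-1` B j))%E.

(* [xi f n] is the [n]-th jump of frog [f] in the model with drift [rho]. *)
Definition frog_model d (T : measurableType d) (R : realType)
    (P : probability T R) (rho : R) (eta : nat -> nat)
    (xi : frog eta -> nat -> {RV P >-> bool}) : Prop :=
  let p := 1 / (1 + rho) in
  (forall f n, P (xi f n @^-1` [set true]) = p%:E /\
               P (xi f n @^-1` [set false]) = (1 - p)%:E) /\
  mutually_independent (fun k : {x : nat & 'I_(eta x)} * nat => xi k.1 k.2).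

Definition same_law d d1 d2 (T1 : measurableType d1) (T2 : measurableType d2)
    (E : measurableType d) (R : realType)
    (P1 : probability T1 R) (P2 : probability T2 R)
    (X1 : T1 -> E) (X2 : T2 -> E) : Prop :=
  forall B, measurable B -> pushforward P1 X1 B = pushforward P2 X2 B.

(* Main.v *)
Require Import Defs.
From HB Require Import structures.
From mathcomp Require Import all_boot all_order all_algebra.
From mathcomp Require Import all_classical all_reals all_analysis.
From mathcomp Require Import measurable_realfun.
From mathcomp Require Import zify ring lra.
Set Implicit Arguments.
Unset Strict Implicit.
Unset Printing Implicit Defensive.
Import Order.TTheory GRing.Theory Num.Theory.
Import numFieldNormedType.Exports.
Local Open Scope classical_set_scope.
Local Open Scope ring_scope.

(** Let [S] be the generating sum [weighted_sum eta rho]. A frog started at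
    [x] ever reaches [-m] with probability [rho ^+ (x + m)] (gambler's ruin), so
    a union bound gives [P (X >= m) <= rho ^+ m * S].  Conversely, a single frog
    from the origin almost surely visits every [x >= 0] and wakes up everybody;
    keeping one frog per site, independence gives
    [P (X < m) <= \prod_x (1 - rho ^+ (x + m)) <= expR (- rho ^+ m / (1 - rho))].
    With [m] close to [y * ln (1 - rho) / ln rho], the power [rho ^+ m] is about
    [(1 - rho) `^ y]; the first bound vanishes for [y = 1 + e] by the growth
    hypothesis, and the second one for [y = 1 - e]. *)

(** * Passage of a single nearest-neighbour path through a given distance *)

(* The walk with jumps [s] travels the distance [k] in direction [d] within [N]
   jumps. *)
Fixpoint hits (d : bool) (N : nat) (s : nat -> bool) (k : nat) : bool :=
  if k is k'.+1 then
    if N is N'.+1 then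
      hits d N' (fun n => s n.+1) (if s 0%N == d then k' else k'.+2)
    else false
  else true.

(** Counting jumps along [d] as positive lets hits to the right and to the left share one
    treatment. *)
Definition displacement (d : bool) (s : nat -> bool) (a : nat) : int :=
  \sum_(i < a) jump (s i == d).

Lemma displacementS d s a :
  displacement d s a.+1 =
  jump (s 0%N == d) + displacement d (fun n => s n.+1) a.
Proof.
by rewrite /displacement big_ord_recl; congr (_ + _); apply: eq_bigr.
Qed.

Lemma hits_displacement d N s k :
  hits d N s k -> exists a, displacement d s a = k%:Z.
Proof.
elim: N s k => [|N IH] s [|k] //=; try by exists 0%N; rewrite /displacement big_ord0.
move=> /IH [a Ha]; exists a.+1; rewrite displacementS Ha /jump.
by case: ifP; lia.
Qed.

(** Jumps have size one, so a path whose displacement is at least [k] at time [a] cannot have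
    skipped [k] on the way. *)
Lemma displacement_hits d N s k a :
  (a <= N)%N -> k%:Z <= displacement d s a -> hits d N s k.
Proof.
elim: N s k a => [|N IH] s [|k] a //=.
  by case: a => //; rewrite /displacement big_ord0.
case: a => [|a]; first by rewrite /displacement big_ord0.
rewrite displacementS => aN H; apply: (IH _ _ a) => //.
by move: H; rewrite /jump; case: ifP; lia.
Qed.

Lemma hits_homo d s k :
  {homo (fun N => hits d N s k) : N M / (N <= M)%N >-> N ==> M}.
Proof.
move=> N; elim: N s k => [|N IH] s [|k] [|M] //= NM.
by apply: IH.
Qed.

(** * Gambler's ruin: hitting probabilities as the time horizon [N] tends to infinity *)

Lemma cvgn_le (R : realType) (u : R^nat) (l b : R) :
  u n @[n --> \oo] --> l -> (forall n, u n <= b) -> l <= b.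
Proof.
move=> ul ub; rewrite -(cvg_lim _ ul)//.
by apply: limr_le; [apply/cvg_ex; exists l|apply: nearW].
Qed.

Lemma cvgn_ge (R : realType) (u : R^nat) (l b : R) :
  u n @[n --> \oo] --> l -> (forall n, b <= u n) -> b <= l.
Proof.
move=> ul ub; rewrite -(cvg_lim _ ul)//.
by apply: limr_ge; [apply/cvg_ex; exists l|apply: nearW].
Qed.

(* The probability of [hits d N s k] when jumps in direction [d] have
   probability [q]. *)
Fixpoint hit_prob (R : realType) (q : R) (N k : nat) : R :=
  if k is k'.+1 then
    if N is N'.+1 then q * hit_prob q N' k' + (1 - q) * hit_prob q N' k'.+2
    else 0
  else 1.

Section hit_prob.
Variables (R : realType) (r : R).
Hypothesis r_gt0 : 0 < r.
Let r1_gt0 : 0 < 1 + r. Proof. by rewrite addr_gt0. Qed.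

(** With this parametrization [r] is the odds ratio [q / (1 - q)], the base of the gambler's ruin
    formula. Later [r] is [rho] for leftward hits and [rho^-1] for rightward ones. *)
Let q := r / (1 + r).

Let q_ge0 : 0 <= q. Proof. by rewrite divr_ge0// ltW. Qed.
Let q_le1 : 0 <= 1 - q.
Proof. by rewrite subr_ge0 ler_pdivrMr// mul1r lerDr. Qed.

Lemma hit_prob_ge0 N k : 0 <= hit_prob q N k.
Proof.
elim: N k => [|N IH] [|k] //=.
by rewrite addr_ge0// mulr_ge0.
Qed.

Lemma hit_prob_le1 N k : hit_prob q N k <= 1.
Proof.
elim: N k => [|N IH] [|k] //=.
rewrite [leRHS](_ : _ = q * 1 + (1 - q) * 1); last by ring.
by rewrite lerD// ler_wpM2l.
Qed.

Lemma hit_prob_homo k : nondecreasing_seq (fun N => hit_prob q N k).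
Proof.
apply/nondecreasing_seqP => N; elim: N k => [|N IH] [|k] //.
  exact: hit_prob_ge0.
by rewrite lerD// ler_wpM2l//; exact: IH.
Qed.

(* [k |-> r ^+ k] is harmonic for the walk. *)
Lemma hit_prob_le N k : hit_prob q N k <= r ^+ k.
Proof.
elim: N k => [|N IH] [|k] //=; first by rewrite exprn_ge0// ltW.
rewrite [leRHS](_ : _ = q * r ^+ k + (1 - q) * r ^+ k.+2); last first.
  by rewrite /q !exprS; field; rewrite gt_eqF.
by rewrite lerD// ler_wpM2l.
Qed.

Let h k := limn (fun N => hit_prob q N k).

Let cvg_h k : hit_prob q N k @[N --> \oo] --> h k.
Proof.
apply: (nondecreasing_is_cvgn (@hit_prob_homo k)).
by exists 1 => _ [N _ <-]; exact: hit_prob_le1.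
Qed.

Let h0 : h 0 = 1.
Proof.
apply/cvg_lim => //; rewrite (_ : (fun _ => _) = cst 1); first exact: cvg_cst.
by apply/funext => -[].
Qed.

Let h_ge0 k : 0 <= h k.
Proof. by apply: (cvgn_ge (@cvg_h k)) => N; exact: hit_prob_ge0. Qed.

Let h_le b k : (forall N, hit_prob q N k <= b) -> h k <= b.
Proof. exact: cvgn_le. Qed.

Let hS k : h k.+1 = q * h k + (1 - q) * h k.+2.
Proof.
apply/cvg_lim => //.
rewrite -(cvg_shiftS (fun N => hit_prob q N k.+1)) /=.
by apply: cvgD; apply: (cvgM (cvg_cst _)); exact: cvg_h.
Qed.

(** The recursion [hS] says that consecutive increments of [h] have ratio [r]. *)
Let dh k : h k.+1 - h k = r ^+ k * (h 1 - 1).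
Proof.
elim: k => [|k IH]; first by rewrite h0 expr0 mul1r.
rewrite exprS -mulrA -IH.
have := hS k; rewrite /q => H.
have r1 : 1 + r != 0 by rewrite gt_eqF.
have : (1 + r) * h k.+1 = r * h k + h k.+2 by rewrite H; field.
lra.
Qed.

(** A first integral of the recursion [hS]: this combination does not depend on [k], and its value
    is read off at [k = 0]. *)
Let lh k : h k.+1 - r * h k = h 1 - r.
Proof.
elim: k => [|k IH]; first by rewrite h0 mulr1.
have := dh k.+1; have := dh k; rewrite exprS -mulrA => <-; lra.
Qed.

(** Since [0 <= h k <= r ^+ k], [h] vanishes at infinity. The constant in [lh] is therefore [0], so
    [h] is geometric with ratio [r]. *)
Lemma hit_prob_cvg k : r < 1 -> hit_prob q N k @[N --> \oo] --> r ^+ k.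
Proof.
move=> r1; suff <- : h k = r ^+ k by exact: cvg_h.
suff h1 : h 1 - r = 0.
  elim: k => [|k IH]; first by rewrite h0.
  by have := lh k; rewrite h1 IH exprS; lra.
have cr : (fun k => r ^+ k) @ \oo --> (0 : R).
  by apply: cvg_expr; rewrite gtr0_norm.
have ch : (fun k => h k) @ \oo --> (0 : R).
  apply: (squeeze_cvgr _ (cvg_cst 0) cr); near=> n.
  by rewrite h_ge0 h_le// => N; exact: hit_prob_le.
have cc : (fun k => h k.+1 - r * h k) @ \oo --> 0 - r * 0.
  apply: cvgB; first by rewrite (cvg_shiftS h).
  exact: (cvgM (cvg_cst _)).
rewrite mulr0 subr0 (_ : (fun _ => _) = cst (h 1 - r)) in cc; last first.
  by apply/funext => n; rewrite lh.
exact: (cvg_unique _ (cvg_cst _) cc).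
Unshelve. all: by end_near. Qed.

(** By [dh] the increments of [h] grow like [r ^+ k] unless [h 1 = 1], but [h] takes values in
    [[0, 1]]. *)
Lemma hit_prob_cvg1 k : 1 < r -> hit_prob q N k @[N --> \oo] --> (1 : R).
Proof.
move=> r1; suff h1 : h 1 - 1 = 0.
  suff <- : h k = 1 by exact: cvg_h.
  by elim: k => [//|k IH]; have := dh k; rewrite h1 IH mulr0; lra.
have lb n : `|h 1 - 1| <= r^-1 ^+ n.
  rewrite exprVn -[leRHS]mul1r ler_pdivlMr ?exprn_gt0// mulrC.
  rewrite -[X in X * _](gtr0_norm (exprn_gt0 _ r_gt0)) -normrM -dh.
  have := h_ge0 n.+1; have := h_ge0 n.
  have := h_le (hit_prob_le1^~ n); have := h_le (hit_prob_le1^~ n.+1).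
  by rewrite ler_norml; lra.
apply/normr0_eq0/eqP; rewrite eq_le normr_ge0 andbT.
have cr : (fun n => r^-1 ^+ n) @ \oo --> (0 : R).
  by apply: cvg_expr; rewrite gtr0_norm ?invr_gt0// invf_lt1.
exact: (cvgn_ge cr).
Qed.

End hit_prob.

(** * Hitting events of walks driven by independent bits *)

Section independent_bits.
Context d (T : measurableType d) (R : realType) (P : probability T R).
Variables (I : choiceType) (X : I -> {RV P >-> bool}).

(* [U] collects the bits not yet inspected by [C]: revealing bits one at a time
   computes the law of a hitting event along its recursion, without summing
   over finite patterns of bits. *)
Definition independent_of (U : set I) (C : set T) : Prop :=
  measurable C /\ forall (L : seq I) (B : I -> set bool),
    uniq L -> [set` L] `<=` U ->
    P (C `&` \bigcap_(j in [set` L]) (X j @^-1` B j)) =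
    (P C * \prod_(j <- L) P (X j @^-1` B j))%E.

Lemma measurable_bit i (A : set bool) : measurable (X i @^-1` A).
Proof. by rewrite -[X in measurable X]setTI; exact: measurable_funP. Qed.

Lemma measurable_bits (L : seq I) (B : I -> set bool) :
  measurable (\bigcap_(j in [set` L]) (X j @^-1` B j)).
Proof.
by apply: fin_bigcap_measurable => // j _; exact: measurable_bit.
Qed.

Lemma independent_ofT :
  mutually_independent X -> independent_of setT setT.
Proof.
move=> ind; split=> // L B uL _.
by rewrite setTI probability_setT mul1e ind.
Qed.

Lemma independent_of_sub U V C :
  V `<=` U -> independent_of U C -> independent_of V C.
Proof.
by move=> VU [mC H]; split=> // L B uL LV; apply: H => // x /LV; exact: VU.
Qed.

Lemma independent_of_bit U C i b : U i -> independent_of U C ->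
  independent_of (U `\ i) (C `&` X i @^-1` [set b]) /\
  P (C `&` X i @^-1` [set b]) = (P C * P (X i @^-1` [set b]))%E.
Proof.
move=> Ui [mC H].
have E : P (C `&` X i @^-1` [set b]) = (P C * P (X i @^-1` [set b]))%E.
  have /= := H [:: i] (fun=> [set b]).
  rewrite big_seq1 => <- //; last by move=> x /=; rewrite inE => /eqP ->.
  by rewrite set_cons1 bigcap_set1.
split=> //; split; first exact: measurableI _ (measurable_bit _ _).
move=> L B uL LU.
have iL : i \notin L by apply/negP => iL; have [_] := LU i iL; exact.
(* [B'] prescribes [b] at [i] and agrees with [B] on [L], so the independence of [C] applies to the
   longer list [i :: L]. *)
pose B' j := if j == i then [set b] else B j.
have BB' j : j \in L -> B' j = B j.
  by rewrite /B'; case: eqP => // -> ; rewrite (negbTE iL).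
have := H (i :: L) B'; rewrite big_cons /= iL uL => /(_ isT) H'.
rewrite E -muleA.
transitivity (P (C `&` \bigcap_(j in [set` i :: L]) X j @^-1` B' j)).
  rewrite -setIA; congr (P (_ `&` _)).
  rewrite !bigcap_seq big_cons {1}/B' eqxx; congr (_ `&` _).
  by apply: eq_big_seq => j /BB' ->.
rewrite H'; last by move=> x /=; rewrite inE => /predU1P[->//|/LU[]].
rewrite {1}/B' eqxx; congr (_ * (_ * _))%E.
by apply: eq_big_seq => j /BB' ->.
Qed.

Lemma independent_of_setU U C D : C `&` D = set0 ->
  independent_of U C -> independent_of U D -> independent_of U (C `|` D).
Proof.
move=> CD [mC HC] [mD HD]; split; first exact: measurableU.
move=> L B uL LU.
have mB := measurable_bits L B.
rewrite setIUl !measureU//; last 3 first.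
- exact: measurableI.
- exact: measurableI.
- by rewrite setIACA CD set0I.
rewrite ge0_muleDl//; congr (_ + _)%E; [exact: HC|exact: HD].
Qed.

(** The complement of hitting is the useful event: in the lower-tail bound many walks must miss
    their targets simultaneously. *)
Definition avoid dd N (g : nat -> I) k : set T :=
  [set w | ~~ hits dd N (fun n => X (g n) w) k].

Lemma avoid0 dd N g : avoid dd N g 0 = set0.
Proof. by apply/seteqP; split=> w //; rewrite /avoid /=; case: N. Qed.

Lemma avoid0S dd g k : avoid dd 0 g k.+1 = setT.
Proof. by apply/seteqP; split. Qed.

Lemma avoidSS dd N g k : let g' n := g n.+1 in
  avoid dd N.+1 g k.+1 = X (g 0%N) @^-1` [set dd] `&` avoid dd N g' k `|`
                         X (g 0%N) @^-1` [set ~~ dd] `&` avoid dd N g' k.+2.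
Proof.
apply/seteqP; split=> w; rewrite /avoid /=.
  case: eqP => [->|/eqP nd ?]; [by left|right; split=> //].
  by move: nd; case: (X _ w); case: (dd).
by case=> -[->]; rewrite ?eqxx//; case: dd.
Qed.

(** First-step analysis. [C] is arbitrary so that the induction hypothesis applies after the first
    bit is added to it; the target is then at distance [k] or [k.+2]. The independence conclusion
    allows further walks to be treated afterwards. *)
Lemma avoid_independent dd q U C (g : nat -> I) N k :
  (forall i b, P (X i @^-1` [set b]) = (if b == dd then q else 1 - q)%:E) ->
  injective g -> range g `<=` U -> independent_of U C ->
  independent_of (U `\` range g) (C `&` avoid dd N g k) /\
  P (C `&` avoid dd N g k) = (P C * (1 - hit_prob q N k)%:E)%E.
Proof.
move=> Pq.
have z N' g' U' C' : independent_of (U' `\` range g') (C' `&` avoid dd N' g' 0) /\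
  P (C' `&` avoid dd N' g' 0) = (P C' * (1 - hit_prob q N' 0)%:E)%E.
  rewrite avoid0 setI0 measure0 (_ : hit_prob q N' 0 = 1) ?subrr ?mule0; last first.
    by case: N'.
  by split=> //; split=> // L B _ _; rewrite set0I measure0 mul0e.
elim: N k g U C => [|N IH] [|k] g U C gI gU indC.
- exact: z.
- rewrite avoid0S setIT /= subr0 mule1; split=> //.
  by apply: independent_of_sub indC; exact: subDsetl.
- exact: z.
have Ug0 : U (g 0%N) by apply: gU; exists 0%N.
have gI' : injective (fun n => g n.+1) by move=> x y /gI [].
have gU' : range (fun n => g n.+1) `<=` U `\ g 0%N.
  by move=> _ [n _ <-]; split; [apply: gU; exists n.+1|move=> /gI].
have UE : U `\ g 0%N `\` range (fun n => g n.+1) = U `\` range g.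
  apply/seteqP; split=> x /=.
    move=> [[Ux x0] xn]; split=> // -[[|n] _ nx]; first by apply: x0.
    by apply: xn; exists n.
  move=> [Ux xn]; split; first by split=> // x0; apply: xn; exists 0%N.
  by move=> [n _ nx]; apply: xn; exists n.+1.
have [iT ET] := independent_of_bit dd Ug0 indC.
have [iF EF] := independent_of_bit (~~ dd) Ug0 indC.
have {iT} [iT ET'] := IH k _ _ _ gI' gU' iT.
have {iF} [iF EF'] := IH k.+2 _ _ _ gI' gU' iF.
rewrite UE in iT iF.
rewrite avoidSS setIUr !setIA.
set C1 := C `&` _ `&` _ in iT ET' *; set C2 := C `&` _ `&` _ in iF EF' *.
(* The two cases prescribe opposite values of the first bit, so their probabilities add. *)
have C120 : C1 `&` C2 = set0.
  by rewrite -subset0 => w [[[_ /= Xt] _] [[_ /=]]]; rewrite Xt; case: (dd).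
split; first exact: independent_of_setU.
rewrite measureU//; [|exact: iT.1|exact: iF.1].
rewrite [X in (X + _)%E]ET' [X in (_ + X)%E]EF' ET EF !Pq eqxx.
rewrite (_ : ~~ dd == dd = false); last by case: (dd).
rewrite -(fineK (fin_num_measure P _ indC.1)) -!EFinM -EFinD; congr EFin.
by rewrite /=; ring.
Qed.

Lemma avoid_independent_prod dd q (G : nat -> nat -> I) N (k : nat -> nat) K :
  (forall i b, P (X i @^-1` [set b]) = (if b == dd then q else 1 - q)%:E) ->
  mutually_independent X ->
  (forall x y m n, G x m = G y n -> x = y /\ m = n) ->
  P (\big[setI/setT]_(x < K) avoid dd N (G x) (k x)) =
  (\prod_(x < K) (1 - hit_prob q N (k x)))%:E.
Proof.
move=> Pq ind GI.
suff [] : independent_of [set i | forall x n, (x < K)%N -> i <> G x n]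
            (\big[setI/setT]_(x < K) avoid dd N (G x) (k x)) /\
          P (\big[setI/setT]_(x < K) avoid dd N (G x) (k x)) =
          (\prod_(x < K) (1 - hit_prob q N (k x)))%:E by [].
elim: K => [|K [IH1 IH2]].
  rewrite !big_ord0 probability_setT; split=> //.
  by apply: independent_of_sub (independent_ofT ind).
rewrite !big_ord_recr /=.
have [||H1 H2] := avoid_independent (g := G K) N (k K) Pq _ _ IH1.
- by move=> m n /GI [].
- by move=> _ [n _ <-] x m xK /GI [] E; rewrite E ltnn in xK.
rewrite H2 IH2 EFinM; split=> //; apply: independent_of_sub H1 => i /= Hi.
split=> [x n xK|[n _ E]]; first by apply: Hi; rewrite ltnS ltnW.
by apply: (Hi K n); rewrite ?ltnSn ?E.
Qed.

Lemma avoid_prob dd q (g : nat -> I) N k :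
  (forall i b, P (X i @^-1` [set b]) = (if b == dd then q else 1 - q)%:E) ->
  mutually_independent X -> injective g ->
  measurable (avoid dd N g k) /\
  P (avoid dd N g k) = (1 - hit_prob q N k)%:E.
Proof.
move=> Pq ind gI.
have [] := avoid_independent N k Pq gI (@subsetT _ _) (independent_ofT ind).
by rewrite setTI probability_setT mul1e => -[].
Qed.

End independent_bits.

(** * Pathwise facts about the frog dynamics *)

Section frogs.
Variable eta : nat -> nat.
Implicit Types (s : steps eta) (f : frog eta).

Lemma walk_right s f a : walk s f a = (tag f)%:Z + displacement true (s f) a.
Proof.
by congr (_ + _); apply: eq_bigr => i _; rewrite eqb_id.
Qed.

Lemma walk_left s f a : walk s f a = (tag f)%:Z - displacement false (s f) a.
Proof.
congr (_ + _); rewrite -sumrN; apply: eq_bigr => i _.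
by case: (s f i).
Qed.

Lemma walkS s f a : walk s f a.+1 = walk s f a + jump (s f a).
Proof. by rewrite /walk big_ord_recr addrA. Qed.

Lemma awakeD s t x b c : awake s t x = Some b -> awake s (t + c) x = Some (b + c)%N.
Proof.
by move=> H; elim: c => [|c IH]; rewrite ?addn0// !addnS /= IH.
Qed.

Lemma awake_start s t x b : awake s t x = Some b ->
  exists t', awake s t' x = Some 0%N.
Proof.
elim: t b => [|t IH] b.
  by rewrite /=; case: eqP => // -> _; exists 0%N.
move=> H; case E : (awake s t x) => [b'|]; first exact: IH E.
by exists t.+1; move: H; rewrite /= E; case: ifP.
Qed.

Lemma awake0 s t : awake s t 0 = Some t.
Proof. exact: (@awakeD s 0 0 0 t). Qed.

(** A frog from the origin is awake from time [0], so its number of jumps is the global time.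
    Standing at [x] at time [a], it finds [x] awake or wakes it. *)
Lemma hit_awake s f a (x : nat) : tag f = 0%N -> walk s f a = x%:Z ->
  exists t b, awake s t x = Some b.
Proof.
move=> f0; case: a => [|a] fx.
  exists 0%N, 0%N; move: fx; rewrite /walk big_ord0 addr0 f0 => -[<-].
  exact: awake0.
exists a.+1; rewrite /=; case: (awake s a x) => [b|]; first by exists b.+1.
exists 0%N; case: asboolP => // -[]; exists f, a; rewrite f0 awake0.
by [].
Qed.

(** The frog [f0] wakes every site by itself; any other frog then completes its whole path, delayed
    by the time [t'] at which its site woke up. *)
Lemma all_visited s f0 : tag f0 = 0%N ->
  (forall x : nat, exists a, walk s f0 a = x%:Z) ->
  forall f a, visited s (walk s f a).
Proof.
move=> f00 H f a; have [a0 /(hit_awake f00)[t [b]]] := H (tag f).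
move=> /awake_start[t' H']; exists (t' + a)%N, f, a.
by rewrite (awakeD _ H').
Qed.

Lemma neg_min_visited_gt (R : realType) s (r : R) (m : nat) :
  m%:R <= r + 1 -> (r%:E < neg_min_visited R s)%E ->
  exists f N, hits false N (s f) (tag f + m).
Proof.
move=> mr; rewrite /neg_min_visited lteNr => /ereal_inf_lt[_ [z [t [f [a [_ <-]]]] <-]].
rewrite lte_fin => zr; exists f, a; apply: (displacement_hits (leqnn a)).
suff : walk s f a <= - m%:Z by rewrite walk_left; lia.
(* The walk takes integer values, which turns the strict bound into the unit of slack allowed by
   [m%:R <= r + 1]. *)
suff : walk s f a < - m%:Z + 1 by lia.
rewrite -(ltr_int R) [ltRHS]intrD intrN (lt_le_trans zr)//=.
by rewrite -pmulrn; lra.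
Qed.

Lemma neg_min_visited_lt (R : realType) s (r : R) (m : nat) :
  r <= m%:R -> (neg_min_visited R s < r%:E)%E ->
  forall f a, walk s f a = - m%:Z -> ~ visited s (walk s f a).
Proof.
move=> rm; rewrite /neg_min_visited lteNl => H f a fm /= vis.
have := lt_le_trans H (ereal_inf_lbound (ex_intro2 _ _ _ vis erefl)).
by rewrite lte_fin fm intrN -pmulrn ltrN2 ltNge rm.
Qed.

End frogs.

(** * Measurability of the minimum of the visited set *)

Section measurability.
Context d (T : measurableType d) (R : realType) (P : probability T R).
Variables (eta : nat -> nat) (xi : frog eta -> nat -> {RV P >-> bool}).
Let s w : steps eta := fun f n => xi f n w.

Lemma measurable_const (Q : Prop) : measurable [set _ : T | Q].
Proof.
have [q|nq] := pselect Q.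
  by rewrite (_ : [set _ | _] = setT)//; apply/seteqP; split.
by rewrite (_ : [set _ | _] = set0)//; apply/seteqP; split.
Qed.

Lemma measurable_exists (U : countType) (F : U -> T -> Prop) :
  (forall u, measurable [set w | F u w]) -> measurable [set w | exists u, F u w].
Proof.
move=> mF; rewrite (_ : [set _ | _] = \bigcup_u [set w | F u w]).
  exact: countable_bigcupT_measurable.
by apply/seteqP; split=> w /= => [[u ?]|[u _ ?]]; exists u.
Qed.

Lemma measurable_walk f a z : measurable [set w | walk (s w) f a = z].
Proof.
elim: a z => [|a IH] z.
  rewrite (_ : [set _ | _] = [set _ | (tag f)%:Z = z]).
    exact: measurable_const.
  by apply/seteqP; split=> w /=; rewrite /walk big_ord0 addr0.
rewrite (_ : [set _ | _] =
  (xi f a @^-1` [set true] `&` [set w | walk (s w) f a = z - 1]) `|`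
  (xi f a @^-1` [set false] `&` [set w | walk (s w) f a = z + 1])).
  by apply: measurableU; apply: measurableI => //; exact: measurable_bit.
have wS w : walk (s w) f a.+1 = walk (s w) f a + (if xi f a w then 1 else -1).
  exact: walkS.
apply/seteqP; split=> w /=; rewrite wS.
  by case: (xi f a w) => <-; [left|right]; split=> //; lia.
by case=> -[-> ->]; lia.
Qed.

(** Induction on time for all sites at once: the status of [x] at time [t.+1] is determined by its
    status at time [t] and by the event [E] that an awake frog jumps onto [x]. *)
Lemma measurable_awake t x o : measurable [set w | awake (s w) t x = o].
Proof.
elim: t x o => [|t IH] x o.
  exact: (measurable_const ((if x == 0 then Some 0 else None) = o)%N).
pose E := [set w | exists (f : frog eta) (a : nat),
  awake (s w) t (tag f) = Some a /\ walk (s w) f a.+1 = x%:Z].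
have mE : measurable E.
  apply: measurable_exists => f; apply: measurable_exists => a.
  by apply: measurableI; [exact: IH|exact: measurable_walk].
have mN := IH x None.
case: o => [[|a]|].
- rewrite (_ : [set _ | _] = [set w | awake (s w) t x = None] `&` E).
    exact: measurableI.
  apply/seteqP; split=> w /=; case: (awake _ _ _) => [b|] //.
  - by case: asboolP.
  - by case.
  - by move=> [_ ?]; case: asboolP.
- rewrite (_ : [set _ | _] = [set w | awake (s w) t x = Some a])//.
  apply/seteqP; split=> w /=; case: (awake _ _ _) => [b|]//; try by move=> [->].
  by case: asboolP.
- rewrite (_ : [set _ | _] = [set w | awake (s w) t x = None] `\` E).
    exact: measurableD.
  apply/seteqP; split=> w /=; case: (awake _ _ _) => [b|] //.
  - by case: asboolP.
  - by case.
  - by move=> [_ ?]; case: asboolP.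
Qed.

Lemma measurable_visited z : measurable [set w | visited (s w) z].
Proof.
do 3 apply: measurable_exists => ?.
by apply: measurableI; [exact: measurable_awake|exact: measurable_walk].
Qed.

(** The infimum is below [r] exactly when some visited integer is, and this is a countable union of
    measurable events. *)
Lemma measurable_neg_min_visited :
  measurable_fun setT (fun w => neg_min_visited R (s w)).
Proof.
apply: measurableT_comp => //.
apply: (measurability _ (ErealGenInftyO.measurableE R)) => _ /= -[_ [r ->] <-].
rewrite setTI.
rewrite (_ : _ @^-1` _ = [set w | exists z : int, visited (s w) z /\ z%:~R < r]).
  apply: measurable_exists => z; apply: measurableI; last exact: measurable_const.
  exact: measurable_visited.
apply/seteqP; split=> w /=; rewrite in_itv /=.
  by move=> /ereal_inf_lt[_ [z zv <-]]; rewrite lte_fin; exists z.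
move=> [z [zv zr]]; apply: (le_lt_trans (ereal_inf_lbound _)) (_ : (z%:~R%:E < r%:E)%E).
  by exists z.
by rewrite lte_fin.
Qed.

End measurability.

(** * Hitting within unlimited time *)

Section hitting_probability.
Context d (T : measurableType d) (R : realType) (P : probability T R).
Variables (I : choiceType) (X : I -> {RV P >-> bool}).
Variables (dd : bool) (r : R) (g : nat -> I) (k : nat).
Let q := r / (1 + r).
Hypothesis r_gt0 : 0 < r.
Hypothesis Pq :
  forall i b, P (X i @^-1` [set b]) = (if b == dd then q else 1 - q)%:E.
Hypothesis indX : mutually_independent X.
Hypothesis g_inj : injective g.

Let m_avoid N : measurable (avoid X dd N g k).
Proof. by have [] := avoid_prob N k Pq indX g_inj. Qed.

Lemma measurable_hits : measurable [set w | exists N, hits dd N (X^~ w \o g) k].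
Proof.
apply: measurable_exists => N.
rewrite (_ : [set _ | _] = ~` avoid X dd N g k); first exact: measurableC.
by apply/seteqP; split=> w /=; rewrite /avoid /=; case: hits => // /(_ isT).
Qed.

(** Continuity from below: the events of hitting within [N] jumps increase with [N], and each has
    probability at most [r ^+ k]. *)
Lemma hit_prob_ub :
  (P [set w | exists N, hits dd N (X^~ w \o g) k] <= (r ^+ k)%:E)%E.
Proof.
pose F N := ~` avoid X dd N g k.
have FE w N : F N w = hits dd N (X^~ w \o g) k :> Prop.
  by apply/propext; rewrite /F /avoid /=; case: hits; split=> // /(_ isT).
have mF N : measurable (F N) by exact: measurableC.
have E : [set w | exists N, hits dd N (X^~ w \o g) k] = \bigcup_N F N.
  apply/seteqP; split=> w /=; first by move=> [N h]; exists N; rewrite ?FE.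
  by move=> [N _]; rewrite FE => h; exists N.
have c : (P \o F) x @[x --> \oo] --> P (\bigcup_N F N).
  apply: nondecreasing_cvg_mu => //; first exact: bigcup_measurable.
  move=> N M NM; apply/subsetPset => w; rewrite !FE.
  exact/implyP/hits_homo.
rewrite E -(cvg_lim _ c)//; apply: lime_le; first by apply/cvg_ex; eexists; exact: c.
apply: nearW => N /=; rewrite probability_setC//.
have [_ ->] := avoid_prob N k Pq indX g_inj.
by rewrite -EFinB lee_fin subKr hit_prob_le.
Qed.

Lemma never_hit : 1 < r -> P (\bigcap_N avoid X dd N g k) = 0%E.
Proof.
move=> r1; have mZ : measurable (\bigcap_N avoid X dd N g k).
  exact: bigcap_measurable.
apply/eqP; rewrite eq_le measure_ge0 andbT.
rewrite -(fineK (fin_num_measure P _ mZ)) lee_fin.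
have c : 1 - hit_prob q N k @[N --> \oo] --> 1 - (1 : R).
  by apply: cvgB; [exact: cvg_cst|exact: hit_prob_cvg1].
rewrite subrr in c; apply: (cvgn_ge c) => N.
have [_ PN] := avoid_prob N k Pq indX g_inj.
rewrite -lee_fin -PN fineK ?fin_num_measure//.
apply: le_measure; rewrite ?inE//.
by move=> w; apply.
Qed.

End hitting_probability.

(** * Tail bounds for the minimum at fixed drift *)

Lemma measure_bigsetU_le d (T : measurableType d) (R : realType)
    (P : {measure set T -> \bar R}) (I : Type) (s : seq I) (F : I -> set T) :
  (forall i, measurable (F i)) ->
  (P (\big[setU/set0]_(i <- s) F i) <= \sum_(i <- s) P (F i))%E.
Proof.
move=> mF; elim: s => [|i s IH]; first by rewrite !big_nil measure0.
rewrite !big_cons; apply: le_trans (measureU2 _ _ _) _ => //.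
  exact: bigsetU_measurable.
by rewrite leeD2l.
Qed.

Section frog_bounds.
Context d (T : measurableType d) (R : realType) (P : probability T R).
Variables (rho : R) (eta : nat -> nat) (xi : frog eta -> nat -> {RV P >-> bool}).
Hypothesis rho01 : 0 < rho < 1.
Hypothesis eta_gt0 : forall x, (0 < eta x)%N.
Hypothesis model : frog_model rho xi.
Let s w : steps eta := fun f n => xi f n w.
Let X (i : frog eta * nat) := xi i.1 i.2.

Let rho_gt0 : 0 < rho. Proof. by case/andP: rho01. Qed.
Let rho_lt1 : rho < 1. Proof. by case/andP: rho01. Qed.
Let rhoV_gt1 : 1 < rho^-1. Proof. by rewrite invf_gt1. Qed.
Let rhoV_gt0 : 0 < rho^-1. Proof. by rewrite invr_gt0. Qed.
Let indX : mutually_independent X. Proof. exact: model.2. Qed.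

Let rho1_neq0 : 1 + rho != 0. Proof. by rewrite gt_eqF// addr_gt0. Qed.

(** The same bits are read in two ways: jumps to the left have odds [rho < 1], jumps to the right
    have odds [rho^-1 > 1]. Leftward hits thus get geometric probabilities and rightward hits are
    almost sure. *)
Let P_left i b : P (X i @^-1` [set b]) =
  (if b == false then rho / (1 + rho) else 1 - rho / (1 + rho))%:E.
Proof.
have [Pt Pf] := model.1 i.1 i.2.
by case: b; rewrite /= ?Pt ?Pf; congr EFin; field.
Qed.

Let P_right i b : P (X i @^-1` [set b]) =
  (if b == true then rho^-1 / (1 + rho^-1) else 1 - rho^-1 / (1 + rho^-1))%:E.
Proof.
have [Pt Pf] := model.1 i.1 i.2.
by case: b; rewrite /= ?Pt ?Pf; congr EFin; field; rewrite addrC rho1_neq0 gt_eqF.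
Qed.

Let pair_inj (f : frog eta) : injective (fun n : nat => (f, n)).
Proof. by move=> m n []. Qed.

Lemma neg_min_visited_ub (a : R) (m : nat) : m%:R <= a + 1 ->
  (P [set w | (a%:E < neg_min_visited R (s w))%E] <=
   (rho ^+ m)%:E * weighted_sum eta rho)%E.
Proof.
move=> ma.
(* Every frog is counted, whether or not it ever wakes up, since its jumps are defined in any
   case. *)
pose H f := [set w | exists N, hits false N (s w f) (tag f + m)].
have mH f : measurable (H f).
  exact: (measurable_hits (tag f + m) P_left indX (@pair_inj f)).
have PH f : (P (H f) <= (rho ^+ (tag f + m))%:E)%E.
  exact: (hit_prob_ub _ rho_gt0 P_left indX (@pair_inj f)).
pose F x := \big[setU/set0]_(i < eta x) H (existT _ x i).
have mF x : measurable (F x) by exact: bigsetU_measurable.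
have mX : measurable [set w | (a%:E < neg_min_visited R (s w))%E].
  rewrite -[X in measurable X]setTI; apply: emeasurable_fun_o_infty => //.
  exact: measurable_neg_min_visited.
apply: (@le_trans _ _ (\sum_(0 <= x <oo) P (F x))%E).
  apply: measure_sigma_subadditive => // w /= /(neg_min_visited_gt ma)[[x i] [N h]].
  exists x => //; rewrite /F -bigcup_seq; exists i; first by rewrite /= mem_index_enum.
  by exists N.
rewrite /weighted_sum -nneseriesZl; last first.
  by move=> x _; rewrite lee_fin mulr_ge0// exprn_ge0// ltW.
apply: lee_nneseries => // x _.
apply: le_trans (measure_bigsetU_le _ _ _) _ => //.
apply: (@le_trans _ _ (\sum_(i < eta x) (rho ^+ (x + m))%:E)%E).
  by apply: lee_sum => i _; exact: PH.
rewrite sumEFin sumr_const card_ord -EFinM lee_fin exprD -mulr_natl; lra.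
Qed.

Lemma neg_min_visited_lb (a : R) (m : nat) : a <= m%:R ->
  (P [set w | (neg_min_visited R (s w) < a%:E)%E] <=
   (expR (- (rho ^+ m / (1 - rho))))%:E)%E.
Proof.
move=> am; set A := [set w | _].
have mA : measurable A.
  rewrite -[X in measurable X]setTI; apply: emeasurable_fun_infty_o => //.
  exact: measurable_neg_min_visited.
pose frog0 x : frog eta := existT _ x (Ordinal (eta_gt0 x)).
pose G (x n : nat) := (frog0 x, n).
have GI x y n n' : G x n = G y n' -> x = y /\ n = n' by case.
(* The null event that the chosen frog of the origin misses some site [x >= 0]. *)
pose Z := \bigcup_x \bigcap_N avoid X true N (G 0%N) x.
have mavoid N x : measurable (avoid X true N (G 0%N) x).
  by have [] := avoid_prob N x P_right indX (@pair_inj (frog0 0%N)).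
have mZ : measurable Z.
  by apply: bigcup_measurable => x _; exact: bigcap_measurable.
have PZ : P Z = 0%E.
  apply: measure_negligible => //; apply: negligible_bigcup => x.
  exists (\bigcap_N avoid X true N (G 0%N) x); split=> //.
    exact: bigcap_measurable.
  exact: (never_hit x rhoV_gt0 P_right indX (@pair_inj (frog0 0%N))).
(* From [x], reaching [-m] means travelling [x + m] to the left. Finite [N] and [K] keep the product
   formula exact; both are sent to infinity below. *)
pose B N K := \big[setI/setT]_(x < K) avoid X false N (G x) (x + m).
have mB N K : measurable (B N K).
  apply: bigsetI_measurable => x _.
  by have [] := avoid_prob N (x + m) P_left indX (@pair_inj (frog0 x)).
(* Outside [Z] all sites wake up, so a chosen frog whose path meets [-m] really visits it, against
   [a <= m%:R] and the definition of [A]. *)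
have AZB N K : A `<=` Z `|` B N K.
  move=> w Aw; have [Zw|nZ] := pselect (Z w); [by left|right].
  have reach (x : nat) : exists a, walk (s w) (frog0 0%N) a = x%:Z.
    have [N' h] : exists N', hits true N' (s w (frog0 0%N)) x.
      apply: contrapT => nh; apply: nZ; exists x => // N' _.
      by apply/negP => h; apply: nh; exists N'.
    by have [b bE] := hits_displacement h; exists b; rewrite walk_right bE.
  rewrite /B -bigcap_seq => x _; apply/negP => h.
  have [b bE] := hits_displacement h.
  apply: (neg_min_visited_lt am Aw (f := frog0 x) (a := b)).
    by rewrite walk_left [displacement _ _ _]bE /=; lia.
  exact: (all_visited (f0 := frog0 0%N) erefl reach).
have PA N K : fine (P A) <= \prod_(x < K) (1 - hit_prob (rho / (1 + rho)) N (x + m)).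
  rewrite -lee_fin fineK ?fin_num_measure//.
  rewrite -(avoid_independent_prod N (fun x => x + m)%N K P_left indX GI).
  rewrite -[leRHS]add0e -PZ.
  apply: le_trans (measureU2 _ mZ (mB N K)).
  by apply: le_measure; rewrite ?inE//; exact: measurableU.
(* Here [N] tends to infinity with [K] fixed, and the finite product passes to the limit. *)
have {}PA K : fine (P A) <= \prod_(x < K) (1 - rho ^+ (x + m)).
  apply: (cvgn_ge _ (PA^~ K)).
  elim: K => [|K IH].
    by under eq_cvg do rewrite big_ord0; rewrite big_ord0; exact: cvg_cst.
  under eq_cvg do rewrite big_ord_recr; rewrite big_ord_recr /=.
  apply: cvgM => //; apply: cvgB; first exact: cvg_cst.
  exact: hit_prob_cvg.
(* The inequality [1 - y <= expR (- y)] is applied to each factor, so that the limit in [K] becomes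
   that of a geometric series. *)
have {}PA K : fine (P A) <= expR (- \sum_(x < K) rho ^+ (x + m)).
  apply: le_trans (PA K) _; rewrite -sumrN expR_sum.
  apply: ler_prod => x _; rewrite expR_ge1Dx andbT.
  by rewrite subr_ge0 exprn_ile1 ?ltW.
rewrite -[P A]fineK ?fin_num_measure// lee_fin.
apply: (cvgn_ge _ PA).
apply: continuous_cvg; first exact: continuous_expR.
apply: cvgN.
have -> : (fun K => \sum_(x < K) rho ^+ (x + m)) = series (geometric (rho ^+ m) rho).
  apply/funext => K; rewrite /series /= big_mkord; apply: eq_bigr => i _.
  by rewrite exprD mulrC.
by apply: cvg_geometric_series; rewrite gtr0_norm.
Qed.

End frog_bounds.

(** * Tail bounds on the scale of the theorem *)

Section concentration.
Context d (T : measurableType d) (R : realType) (P : probability T R).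
Variables (rho : R) (eta : nat -> nat) (xi : frog eta -> nat -> {RV P >-> bool}).
Hypothesis rho01 : 0 < rho < 1.
Hypothesis eta_gt0 : forall x, (0 < eta x)%N.
Hypothesis model : frog_model rho xi.
Let X w := neg_min_visited R (fun f n => xi f n w).
Let c := ln rho / ln (1 - rho).

Let rho_gt0 : 0 < rho. Proof. by case/andP: rho01. Qed.
Let rho_lt1 : rho < 1. Proof. by case/andP: rho01. Qed.
Let rho1_gt0 : 0 < 1 - rho. Proof. by rewrite subr_gt0. Qed.
Let lnr_lt0 : ln rho < 0. Proof. exact: ln_lt0. Qed.
Let lnr1_lt0 : ln (1 - rho) < 0.
Proof. by rewrite ln_lt0// rho1_gt0 ltrBlDr ltrDl. Qed.
Let c_gt0 : 0 < c.
Proof. by rewrite /c -mulrNN -invrN divr_gt0// oppr_gt0. Qed.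

Let expr_powR (n : nat) (y : R) :
  n%:R <= y / c -> (1 - rho) `^ y <= rho ^+ n.
Proof.
move=> ny; rewrite /powR gt_eqF// -[X in X ^+ _](lnK rho_gt0) -expRM_natl ler_expR.
rewrite (_ : y * _ = y / c * ln rho); last by rewrite /c; field; rewrite !lt_eqF.
by rewrite ler_wnM2r// ltW.
Qed.

Let powR_expr (n : nat) (y : R) :
  y / c <= n%:R -> rho ^+ n <= (1 - rho) `^ y.
Proof.
move=> ny; rewrite /powR gt_eqF// -[X in X ^+ _](lnK rho_gt0) -expRM_natl ler_expR.
rewrite (_ : y * _ = y / c * ln rho); last by rewrite /c; field; rewrite !lt_eqF.
by rewrite ler_wnM2r// ltW.
Qed.

Lemma neg_min_visited_upper_tail e : 0 < e ->
  (P [set w | ((1 + e) / c)%:E < X w] <=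
   ((1 - rho) `^ (1 + e))%:E * weighted_sum eta rho)%E.
Proof.
move=> e0; set a := (1 + e) / c.
have a0 : 0 <= a by rewrite divr_ge0// ltW// addr_gt0.
have /andP[ta at1] := truncn_itv a0.
(* The integer just above [a] lies in the window from [a] to [a + 1]: large enough for [powR_expr],
   small enough for the union bound. *)
apply: le_trans (neg_min_visited_ub rho01 model (m := (Num.trunc a).+1) _) _.
  by rewrite -natr1 lerD2r.
apply: lee_wpmul2r.
  apply: nneseries_ge0 => n _ _; rewrite lee_fin mulr_ge0// exprn_ge0// ltW//.
by rewrite lee_fin powR_expr// ltW.
Qed.

Lemma neg_min_visited_lower_tail e : 0 < e < 1 ->
  (P [set w | X w < ((1 - e) / c)%:E] <= (rho^-1 * (1 - rho) `^ e)%:E)%E.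
Proof.
move=> /andP[e0 e1]; set a := (1 - e) / c.
have a0 : 0 <= a by rewrite divr_ge0// ltW// subr_gt0.
have /andP[ta at1] := truncn_itv a0.
apply: le_trans (neg_min_visited_lb rho01 eta_gt0 model (m := (Num.trunc a).+1) (ltW at1)) _.
rewrite lee_fin.
set u := (1 - rho) `^ e; have u0 : 0 < u by rewrite powR_gt0.
(* [expr_powR] applies to [Num.trunc a], which is at most [a]; the extra unit in the exponent costs
   a factor [rho], hence the [rho^-1] in the bound. *)
have H : rho / u <= rho ^+ (Num.trunc a).+1 / (1 - rho).
  rewrite exprS -mulrA ler_pM2l// ler_pdivlMr// mulrC.
  apply: le_trans (expr_powR ta).
  by rewrite ler_pdivrMr// -powRD subrK ?powRr1 ?oner_eq0// ltW.
(* [expR (- x) <= x^-1] *)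
rewrite expRN -[leRHS]invrK lef_pV2 ?posrE ?expR_gt0//; last first.
  by rewrite invr_gt0 mulr_gt0// invr_gt0.
rewrite invfM invrK; apply: le_trans H _.
by apply: le_trans (expR_ge1Dx _); rewrite lerDr.
Qed.

Lemma frog_concentration e : 0 < e < 1 ->
  (pushforward P (fun w => c%:E * X w) [set y | e%:E < `|y - 1%:E|] <=
   ((1 - rho) `^ (1 + e))%:E * weighted_sum eta rho +
   (rho^-1 * (1 - rho) `^ e)%:E)%E.
Proof.
move=> e01; have /andP[e0 e1] := e01; rewrite /pushforward.
have mX : measurable_fun setT X := measurable_neg_min_visited xi.
set U := [set w | ((1 + e) / c)%:E < X w]%E.
set L := [set w | X w < ((1 - e) / c)%:E]%E.
have mU : measurable U.
  by rewrite -[U]setTI; exact: emeasurable_fun_o_infty.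
have mL : measurable L.
  by rewrite -[L]setTI; exact: emeasurable_fun_infty_o.
apply: le_trans (leeD (neg_min_visited_upper_tail e0) (neg_min_visited_lower_tail e01)).
apply: le_trans (measureU2 _ mU mL).
apply: le_measure; rewrite ?inE; last 2 first.
- exact: measurableU.
(* As [c > 0], a deviation above [1] puts [w] in [U] and one below puts it in [L]; the infinite
   values are sorted likewise. *)
- move=> w; rewrite /U /L /=; case: (X w) => [x| |] /=.
  + rewrite !lte_fin ltr_pdivrMr// ltr_pdivlMr// lter_normr.
    by move=> /orP[]; [left|right]; lra.
  + by left; rewrite ltry.
  + by right; rewrite ltNyr.
rewrite -[X in measurable X]setTI.
apply: emeasurable_fun_o_infty => //; apply: measurableT_comp => //.
by apply: emeasurable_funB => //; exact: measurable_funeM.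
Qed.

End concentration.

(** * Passage to the limit as [rho] increases to [1] *)

Theorem theorem2 (R : realType) (eta : nat -> nat)
  (eta_adm : admissible R eta)
  (eta_growth : forall delta : R, 0 < delta ->
     (((1 - rho) `^ (1 + delta))%:E * weighted_sum eta rho)%E
       @[rho --> 1^'-] --> 0%:E)
  (d : R -> measure_display) (T : forall rho, measurableType (d rho))
  (P : forall rho, probability (T rho) R)
  (xi : forall rho, frog eta -> nat -> {RV (P rho) >-> bool})
  (model : forall rho : R, 0 < rho < 1 -> frog_model rho (xi rho))
  (d' : R -> measure_display) (T' : forall rho, measurableType (d' rho))
  (P' : forall rho, probability (T' rho) R)
  (Y : forall rho, {RV (P' rho) >-> \bar R})
  (Y_law : forall rho : R, 0 < rho < 1 ->
     same_law (P' rho) (P rho) (Y rho)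
       (fun w => ((ln rho / ln (1 - rho))%:E *
                  neg_min_visited R (fun f n => xi rho f n w))%E)) :
  forall eps : R, 0 < eps ->
    P' rho [set w | (eps%:E < `|Y rho w - 1%:E|)%E] @[rho --> 1^'-] --> 0%:E.
Proof.
(* The lower tail needs [e < 1]; replacing [eps] by a smaller [e] only enlarges the deviation
   event. *)
move=> eps eps0; pose e := Num.min eps (1 / 2).
have e01 : 0 < e < 1.
  by rewrite lt_min eps0 divr_gt0//= gt_min; apply/orP; right; lra.
have /andP[e0 _] := e01.
have cpow : (1 - rho) `^ e @[rho --> 1^'-] --> (0 : R).
  apply: (cvg_comp (fun rho => 1 - rho) _ _ (powR_cvg0 e0)).
  move=> A [r r0 H]; exists r => //= x xr x1; apply: H; last by rewrite /= subr_gt0.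
  by move: xr; rewrite /ball /= sub0r normrN.
have cbound : (((1 - rho) `^ (1 + e))%:E * weighted_sum eta rho +
    (rho^-1 * (1 - rho) `^ e)%:E)%E @[rho --> 1^'-] --> (0%:E : \bar R).
  (* The first term vanishes by the growth hypothesis with [delta = e], the second by [cpow],
     because [rho^-1] tends to [1]. *)
  rewrite -[0%:E]adde0; apply: cvgeD => //; first exact: eta_growth.
  apply/cvg_EFin; first by apply: nearW.
  rewrite -(mulr0 (1^-1)); apply: cvgM => //.
  apply: cvgV; first by rewrite oner_eq0.
  exact: cvg_at_left_filter.
apply: (squeeze_cvge _ (cvg_cst _) cbound).
near=> rho.
have rho01 : 0 < rho < 1 by apply/andP; split; near: rho; [exact: nbhs_left_gt|exact: nbhs_left_lt].
rewrite measure_ge0 /=.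
have mB (r : R) : measurable [set y : \bar R | (r%:E < `|y - 1%:E|)%E].
  rewrite -[X in measurable X]setTI.
  apply: emeasurable_fun_o_infty => //; apply: measurableT_comp => //.
  exact: emeasurable_funB.
apply: le_trans _ (frog_concentration rho01 eta_adm.1 (model rho rho01) e01).
rewrite -Y_law//; apply: le_measure; rewrite ?inE.
- rewrite -[X in measurable X]setTI.
  exact: (measurable_funP (Y rho) measurableT _ (mB eps)).
- rewrite -[X in measurable X]setTI.
  exact: (measurable_funP (Y rho) measurableT _ (mB e)).
move=> w /=; apply: le_lt_trans.
by rewrite lee_fin ge_min lexx.
Unshelve. all: by end_near. Qed.
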